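(* Let $M \ge 1$ and let $\mathcal{J}$ be a functional of sets of $M$ controllers $U = \{u_0(y_0), \dots, u_{M-1}(y_{M-1})\}$, $u_m : \mathbb{R} \to \mathbb{R}$, such that for every $m = 0, \dots, M-1$ $$\mathcal{J}[U] = \int L_m(u_m(y_m), y_m)\, dy_m + \mathcal{R}_m[U_{-m}].$$ For each $m$ let $$C_m(u,y_m) = \left. \frac{\partial \mathcal{J}[U]}{\partial y_m} \right|_{u_m(y_m) = u}$$ be the marginal cost function. If $U$ minimizes $\mathcal{J}$ over all sets of $M$ controllers, then for every $m = 0, \dots, M-1$, $$u_m(y_m) = \operatorname*{argmin}_{u \in \mathbb{R}} C_m(u, y_m) \quad \text{for almost every } y_m \in \mathbb{R},$$ that is, $C_m(u_m(y_m), y_m) = \min_{u \in \mathbb{R}} C_m(u, y_m)$ for almost every $y_m$.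
   Context: Unconstrained control problem (UCP): minimize $\mathcal{J}[U]$ over $U = \{u_0(y_0), u_1(y_1), \dots, u_{M-1}(y_{M-1})\}$, where each controller is a function $u_m : \mathbb{R} \to \mathbb{R}$. $U_{-m}$ denotes the controllers other than $u_m$. The standing assumption is that for each $m$ there are a function $L_m : \mathbb{R} \times \mathbb{R} \to \mathbb{R}$ and a residual functional $\mathcal{R}_m[U_{-m}]$, depending only on $U_{-m}$ and not on $u_m$, with $\mathcal{J}[U] = \int L_m(u_m(y_m), y_m)\, dy_m + \mathcal{R}_m[U_{-m}]$, the integral being with respect to Lebesgue measure on $\mathbb{R}$. $L_m$ may also depend on $U_{-m}$ (omitted from the notation; for a given $U$ it is evaluated with the other controllers $U_{-m}$ of that $U$), and the decomposition into $L_m$ and $\mathcal{R}_m$ need not be unique. ''Almost everywhere'' refers to Lebesgue measure. Meaning of $\partial/\partial y_m$: for a functional written as an integral over $y_m$, $\frac{\partial}{\partial y_m}$ denotes its integrand (density) at $y_m$. Thus $$\frac{\partial \mathcal{J}[U]}{\partial y_m} = L_m(u_m(y_m), y_m) + \frac{\partial \mathcal{R}_m[U_{-m}]}{\partial y_m},$$ where the last term is a real-valued function of $y_m$ (and of $U_{-m}$) that does not depend on $u_m$ or on its value at $y_m$. The notation $|_{u_m(y_m) = u}$ means that the value $u_m(y_m)$ is replaced by $u$. Hence, writing $\rho_m(y_m) = \frac{\partial \mathcal{R}_m[U_{-m}]}{\partial y_m}$, the marginal cost function is $C_m(u, y_m) = L_m(u, y_m) + \rho_m(y_m)$ for all $u,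 y_m \in \mathbb{R}$.
   Formalization: The integral is undefined for general non-measurable controllers: the formula for J is assumed only where the integrand is (Borel) integrable, which is required at U, and each L_m is assumed jointly measurable (off a null set of y_m); without measurability the claim can fail. *)

(* Defs.v *)
From HB Require Import structures.
From mathcomp Require Import all_boot all_order all_algebra.
From mathcomp Require Import all_classical all_reals all_analysis.
Set Implicit Arguments.
Unset Strict Implicit.
Unset Printing Implicit Defensive.
Import Order.TTheory GRing.Theory Num.Theory.
Import numFieldNormedType.Exports.
Local Open Scope classical_set_scope.
Local Open Scope ring_scope.

Definition controllers (R : realType) (M : nat) := 'I_M -> R -> R.

(* The families U_{-m}: typing L_m and R_m over [others R m] is what makes them
   independent of the m-th controller. *)
Definition others (R : realType) (M : nat) (m : 'I_M) :=
  {k : 'I_M | k != m} -> R -> R.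

Definition drop_controller (R : realType) (M : nat) (m : 'I_M)
    (U : controllers R M) : others R m :=
  fun k => U (val k).
Arguments drop_controller {R M} m U.

(* U with the single value u_m(y) replaced by u. *)
Definition set_value (R : realType) (M : nat) (m : 'I_M) (y u : R)
    (U : controllers R M) : controllers R M :=
  fun k z => if (k == m) && (z == y) then u else U k z.

(* The map y |-> L_m(u_m(y), y), where L_m is the one attached to U_{-m}. *)
Definition integrand (R : realType) (M : nat)
    (L : forall m : 'I_M, others R m -> R -> R -> R)
    (m : 'I_M) (U : controllers R M) (y : R) : R :=
  L m (drop_controller m U) (U m y) y.

(* The density of J[U] at y_m = y; rho m W y stands for the density of
   R_m[W] at y. *)
Definition cost_density (R : realType) (M : nat)
    (L : forall m : 'I_M, others R m -> R -> R -> R)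
    (rho : forall m : 'I_M, others R m -> R -> R)
    (m : 'I_M) (U : controllers R M) (y : R) : R :=
  integrand L m U y + rho m (drop_controller m U) y.

Definition marginal_cost (R : realType) (M : nat)
    (L : forall m : 'I_M, others R m -> R -> R -> R)
    (rho : forall m : 'I_M, others R m -> R -> R)
    (m : 'I_M) (U : controllers R M) (u y : R) : R :=
  cost_density L rho m (set_value m y u U) y.

Lemma marginal_costE (R : realType) (M : nat)
    (L : forall m : 'I_M, others R m -> R -> R -> R)
    (rho : forall m : 'I_M, others R m -> R -> R)
    (m : 'I_M) (U : controllers R M) (u y : R) :
  marginal_cost L rho m U u y =
  L m (drop_controller m U) u y + rho m (drop_controller m U) y.
Proof.
rewrite /marginal_cost /cost_density /integrand.
have -> : drop_controller m (set_value m y u U) = drop_controller m U.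
  apply/funext => -[k km]; apply/funext => z.
  by rewrite /drop_controller /set_value /= (negbTE km).
by rewrite /set_value !eqxx.
Qed.

(* Joint measurability, Borel in u and Lebesgue in y: since [lebesgue_measure]
   lives on the Borel sets, this is expressed as agreement with a Borel function
   of (u, y) outside a null set of y's. Nothing is required of f as a function
   of u beyond measurability. *)
Definition jointly_measurable (R : realType) (f : R -> R -> R) : Prop :=
  exists2 g : R * R -> R, measurable_fun [set: R * R] g &
    {ae (@lebesgue_measure R), forall y, forall u, f u y = g (u, y)}.

Definition is_argmin (R : realType) (f : R -> R) (x : R) : Prop :=
  forall x', f x <= f x'.

(* Main.v *)
Require Import Defs.
From HB Require Import structures.
From mathcomp Require Import all_boot all_order all_algebra.
From mathcomp Require Import all_classical all_reals all_analysis.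
From mathcomp Require Import measurable_realfun lra.
Import Order.TTheory GRing.Theory Num.Theory.
Import numFieldNormedType.Exports.
Local Open Scope classical_set_scope.
Local Open Scope ring_scope.

Set Implicit Arguments.
Unset Strict Implicit.
Unset Printing Implicit Defensive.

(** Fix a controller index [m] and freeze the others. By the decomposition of
    [J], minimality of [U] says that [U m] minimizes the integral of
    [y |-> f (w y) y] over all functions [w] making this function integrable,
    where [f] is the cost [L m] attached to the frozen controllers; the density
    of the residual shifts the marginal cost by an amount independent of [u] and
    does not affect its minimizers. If, on a non-negligible set of [y], some
    value [u] had a cost [f u y] below [f (U m y) y], one would change [U m] to
    such a value there and strictly decrease the integral.

    The difficulty is to make that change measurably. Up to a null set, the bad
    [y] form the projection of a Borel set [E] of pairs [(u, y)]. This projection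
    need not be Borel, and as [f] need not be continuous in [u], improving values
    cannot be sought in a countable set. The proof therefore finds
    inside [E] a compact set whose projection has positive measure. Borel
    sets of the plane are analytic ([measurable2_bianalytic]); outer measure
    of the projection is continuous along increasing unions
    ([outer_gt_ascending]); and by Choquet's argument
    ([choquet_capacitability]) a property of that kind is inherited from an
    analytic set by the open neighbourhoods of some compact subset. Over the
    projection of a compact set the least admissible [u] is a measurable
    function of [y] ([compact_selection]), whence a measurable selection of [E]
    on a set of positive finite measure ([measurable_selection]).

    To keep the modified cost integrable, [E] is cut down to pairs with
    [- n <= f u y]; countably many such cuts cover the bad set, so one of them
    has a non-negligible projection ([ae_minimizer_of_integral]). *)

(** * Analytic sets *)

Definition baire := {ptws nat -> nat}.

(** Closed sets of the product with the Baire space, rather than images of the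
    Baire space, are projected: countable unions and intersections then become
    reindexings of the sequence, and no metric on [T] is involved. *)
Definition analytic (T : topologicalType) (A : set T) : Prop :=
  exists2 C : set (T * baire), closed C & A = fst @` C.

(** The factors are discrete, so convergence means that every coordinate is
    eventually constant. *)
Lemma cvg_baire (F : set_system baire) (t : baire) : Filter F ->
  (forall i, F [set s | s i = t i]) -> F --> t.
Proof.
move=> FF Ft; apply/cvg_sup => i A [B [ [V oV <-] /= Vti VA]].
by apply: filterS (Ft i) => s si; apply: VA; rewrite /= si.
Qed.

Lemma baire_coord_continuous i : continuous (fun s : baire => s i).
Proof. exact: (@proj_continuous nat (fun=> nat) i). Qed.

Lemma nbhs_baire_coord (t : baire) i : \forall s \near t, s i = t i.
Proof.
by have := @baire_coord_continuous i t _ (discrete_set1 (t i)).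
Qed.

Lemma reindex_continuous (h : nat -> nat) :
  continuous (fun s : baire => (s \o h : baire)).
Proof. by move=> s; apply: cvg_baire => i; exact: nbhs_baire_coord. Qed.

Lemma closed_reindex (S T : topologicalType) (f : S -> T) (h : nat -> nat)
    (C : set (T * baire)) : continuous f -> closed C ->
  closed [set p : S * baire | C (f p.1, p.2 \o h)].
Proof.
move=> cf; apply: (proj1 (continuous_closedP
  (fun p : S * baire => (f p.1, p.2 \o h : baire)))) => p.
apply: (@cvg_pair _ _ _ (nbhs p) (nbhs (f p.1)) (nbhs (p.2 \o h : baire))).
  exact: (@cvg_comp _ _ _ fst f _ (nbhs p.1) _ cvg_fst (cf p.1)).
exact: (@cvg_comp _ _ _ snd (fun s : baire => s \o h : baire) _ (nbhs p.2) _
  cvg_snd (@reindex_continuous h p.2)).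
Qed.

Lemma closed_analytic (T : topologicalType) (A : set T) :
  closed A -> analytic A.
Proof.
move=> cA; exists (fst @^-1` A).
  by apply: (proj1 (continuous_closedP fst)) cA => p; exact: cvg_fst.
apply/seteqP; split=> [x Ax|_ [p Ap <-]//].
by exists (x, fun=> 0%N).
Qed.

Lemma preimage_analytic (S T : topologicalType) (f : S -> T) (A : set T) :
  continuous f -> analytic A -> analytic (f @^-1` A).
Proof.
move=> cf [C cC ->]; exists [set p : S * baire | C (f p.1, p.2 \o id)].
  exact: (@closed_reindex S T f id C cf cC).
apply/seteqP; split=> [x [ [y s] Cys /= yfx]|_ [ [x s] Cfs <-]/=].
  by exists (x, s) => //=; rewrite -yfx.
by exists (f x, s).
Qed.

(** The first term of the sequence tells which set the point is in, and the
    remaining terms witness this membership. *)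
Lemma bigcup_analytic (T : topologicalType) (A : (set T)^nat) :
  (forall k, analytic (A k)) -> analytic (\bigcup_k A k).
Proof.
move=> aA; have /choice[C C_] k : exists C : set (T * baire),
  closed C /\ A k = fst @` C by have [C] := aA k; exists C.
exists (\bigcap_k ([set p : T * baire | p.2 0%N <> k] `|`
                   [set p : T * baire | C k (p.1, p.2 \o succn)])).
  apply: (@closed_bigI _ nat) => k _; apply: closedU; last first.
    by apply: (@closed_reindex T T id _ (C k)) (C_ k).1 => x; exact: cvg_id.
  apply: (proj1 (continuous_closedP (fun p : T * baire => p.2 0%N))
    _ (~` [set k])) => [p|].
    exact: (@cvg_comp _ _ _ snd (fun s : baire => s 0%N) _ (nbhs p.2) _
      cvg_snd (@baire_coord_continuous 0 p.2)).
  exact: discrete_closed.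
apply/seteqP; split=> [x [k _]|_ [ [x s] Cs <-]].
  rewrite (C_ k).2 => -[ [y s] Cys /= <-].
  exists (y, fun n => if n is m.+1 then s m else k) => //= j _ /=.
  by have [<-|] := eqVneq k j; [right|move/eqP; left].
exists (s 0%N) => //; rewrite (C_ _).2.
by have [//|] := Cs (s 0%N) I; exists (x, s \o succn).
Qed.

(** One sequence encodes, through a pairing of the indices, the witnesses of all
    the memberships at once. *)
Lemma bigcap_analytic (T : topologicalType) (A : (set T)^nat) :
  (forall k, analytic (A k)) -> analytic (\bigcap_k A k).
Proof.
move=> aA; have /choice[C C_] k : exists C : set (T * baire),
  closed C /\ A k = fst @` C by have [C] := aA k; exists C.
exists (\bigcap_k [set p : T * baire | C k (p.1, p.2 \o (fun n => pickle (k, n)))]).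
  apply: (@closed_bigI _ nat) => k _.
  by apply: (@closed_reindex T T id _ (C k)) (C_ k).1 => x; exact: cvg_id.
apply/seteqP; split=> [x Ax|_ [ [x s] Cs <-] k _]; last first.
  rewrite (C_ _).2.
  by exists (x, s \o (fun n => pickle (k, n))) => //; exact: Cs.
have /choice[s Cs] k : exists s : baire, C k (x, s).
  by have := Ax k I; rewrite (C_ k).2 => -[ [y s] Cys /= <-]; exists s.
exists (x, fun n => if unpickle n is Some (k, m) then s k m else 0%N) => //.
move=> k _ /=; suff -> : (fun n => if unpickle n is Some (k, m) then s k m else 0%N)
  \o (fun n => pickle (k, n)) = s k by [].
by apply/funext => n /=; rewrite pickleK.
Qed.

(** Analytic sets are not stable under complement; imposing analyticity on the
    complement too gives a sigma-algebra, so that Borel sets can be reached from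
    closed half-lines. *)
Definition bianalytic (T : topologicalType) (A : set T) : Prop :=
  analytic A /\ analytic (~` A).

Lemma bianalytic_sigma_algebra (T : topologicalType) :
  sigma_algebra [set: T] (@bianalytic T).
Proof.
split.
- by split; apply: closed_analytic; rewrite ?setC0; [exact: closed0|exact: closedT].
- by move=> A [aA aAc]; rewrite setTD; split => //; rewrite setCK.
- move=> A bA; split; first by apply: bigcup_analytic => k; case: (bA k).
  by rewrite setC_bigcup; apply: bigcap_analytic => k; case: (bA k).
Qed.

Lemma bianalytic_itv_cinfty (R : realType) (a : R) : bianalytic `[a, +oo[%classic.
Proof.
split; first by apply: closed_analytic; exact: interval_closed.
rewrite setCitvr.
have -> : `]-oo, a[%classic = \bigcup_n `]-oo, a - n.+1%:R^-1]%classic.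
  apply/seteqP; split=> x /=.
    rewrite in_itv /= => xa.
    have [n ?] := ltr_add_invr xa.
    by exists n => //=; rewrite in_itv /= lerBrDr ltW.
  by move=> [n _] /=; rewrite !in_itv /= => /le_lt_trans; apply; rewrite ltrBlDr ltrDl.
by apply: bigcup_analytic => n; apply: closed_analytic; exact: interval_closed.
Qed.

Lemma measurable_bianalytic (R : realType) (A : set R) :
  measurable A -> bianalytic A.
Proof.
move=> mA; have : (@ocitv R).-sigma.-measurable A := mA.
rewrite RGenCInfty.measurableE {mA}.
move: A; apply: smallest_sub.
  exact: bianalytic_sigma_algebra.
move=> _ [a ->]; exact: bianalytic_itv_cinfty.
Qed.

Lemma measurable2_bianalytic (R : realType) (A : set (R * R)) :
  measurable A -> bianalytic A.
Proof.
apply: smallest_sub; first exact: bianalytic_sigma_algebra.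
move=> _ [ [B /measurable_bianalytic[aB aBc] <-]|[B /measurable_bianalytic[aB aBc] <-]].
  rewrite setTI; split; first by apply: preimage_analytic aB => p; exact: cvg_fst.
  by rewrite preimage_setC; apply: preimage_analytic aBc => p; exact: cvg_fst.
rewrite setTI; split; first by apply: preimage_analytic aB => p; exact: cvg_snd.
by rewrite preimage_setC; apply: preimage_analytic aBc => p; exact: cvg_snd.
Qed.

(** * Capacitability *)

(** [P] stands for the family of sets on which some capacity exceeds a fixed
    level; these two properties are what the construction of a compact set
    keeps of the capacity. *)
Definition ascending_capacity (T : Type) (P : set (set T)) : Prop :=
  (forall A B, A `<=` B -> P A -> P B) /\
  (forall A : (set T)^nat, {homo A : m n / (m <= n)%N >-> m `<=` n} ->
     P (\bigcup_n A n) -> exists n, P (A n)).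

Lemma baire_box_compact (b : nat -> nat) :
  compact [set s : baire | forall i, (s i <= b i)%N].
Proof.
apply: (@tychonoff nat (fun=> nat) (fun i => [set n | (n <= b i)%N])) => i.
by apply: finite_compact; apply: sub_finite_set (finite_II (b i).+1) => n.
Qed.

Lemma fmap_ultra (S T : Type) (f : S -> T) (F : set_system S) :
  UltraFilter F -> UltraFilter (f @ F).
Proof.
move=> UF; split=> [|G PG FG]; first exact: fmap_proper_filter.
apply/seteqP; split => // A GA.
have [//|/(FG (~` A)) GAc] := in_ultra_setVsetC (f @^-1` A) UF.
by have [x []] := filter_ex (filterI GA GAc).
Qed.

Section capacitability.
Variables (T : topologicalType) (P : set (set T)) (C : set (T * baire)).
Hypothesis capP : ascending_capacity P.

Let bounded (l : seq nat) : set T :=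
  [set x | exists2 s : baire, C (x, s) &
     forall i, (i < size l)%N -> (s i <= nth 0%N l i)%N].

(** The admissible values of the next coordinate are unbounded, but they are an
    increasing union of bounded ranges. *)
Lemma bounded_next (X : set T) (l : seq nat) :
  P (X `&` bounded l) -> exists k, P (X `&` bounded (rcons l k)).
Proof.
have [Psub Pup] := capP.
move=> PX; apply: (Pup (fun k => X `&` bounded (rcons l k))).
  move=> m n mn x [Xx [s Cs sl]]; split => //; exists s => // i.
  move=> il; apply: leq_trans (sl i _) _; first by move: il; rewrite !size_rcons.
  by rewrite !nth_rcons; case: ifP => // _; case: ifP.
apply: Psub PX => x [Xx [s Cs sl]].
exists (s (size l)) => //; split => //; exists s => // i.
rewrite size_rcons ltnS nth_rcons leq_eqVlt => /predU1P[->|il].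
  by rewrite ltnn eqxx.
by rewrite il; exact: sl.
Qed.

Lemma bounded_branch (X : set T) : P (X `&` [set x | exists s, C (x, s)]) ->
  exists b : nat -> nat, forall n, P (X `&` bounded (mkseq b n)).
Proof.
move=> PX; have Pnil : P (X `&` bounded [::]).
  by apply: (capP.1 _ _ _ PX) => x [Xx [s Cs]]; split => //; exists s.
have /choice[c Pc] l : exists k, P (X `&` bounded l) ->
    P (X `&` bounded (rcons l k)).
  have [/bounded_next[k Pk]|nP] := pselect (P (X `&` bounded l)).
    by exists k.
  by exists 0%N.
pose l n := iter n (fun l => rcons l (c l)) [::].
exists (fun n => c (l n)) => n.
have -> : mkseq (fun n => c (l n)) n = l n.
  by elim: n => // n IHn; rewrite mkseqS IHn.
by elim: n => //= n; exact: Pc.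
Qed.

(** With [b] bounding the coordinates one after the other, the compact set is the
    projection of the part of [C] over [X] whose sequences are bounded by [b]. If
    an open [V] around it did not satisfy [P], it would contain none of the sets
    [bounded (mkseq b n)] within [X]. Points of these outside [V], with their
    witnesses, accumulate in [C] at a point whose sequence is bounded by [b],
    that is, at a point of the compact set outside [V]. *)
Lemma capacitable_within (X : set T) : compact X -> closed C ->
  P (X `&` [set x | exists s, C (x, s)]) ->
  exists K, [/\ compact K, K `<=` [set x | exists s, C (x, s)] &
    forall V, open V -> K `<=` V -> P V].
Proof.
move=> cptX cC /bounded_branch[b Pb].
pose box := X `*` [set s : baire | forall i, (s i <= b i)%N].
have cptbox : compact box by apply: compact_setX => //; exact: baire_box_compact.
exists (fst @` (box `&` C)); split.
- apply: continuous_compact; last exact: compact_closedI.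
  by apply: continuous_subspaceT => p; exact: cvg_fst.
- by move=> _ [ [x s] [_ Cxs] <-]; exists s.
move=> V oV KV; apply: contrapT => nPV.
have /choice[p pP] n : exists p : T * baire,
    [/\ X p.1, C p, ~ V p.1 & forall i, (i < n)%N -> (p.2 i <= b i)%N].
  apply: contrapT => nex; apply: nPV; apply: (capP.1 _ _ _ (Pb n)) => x.
  move=> [Xx [s Cs sb]]; apply: contrapT => nVx; apply: nex.
  exists (x, s); split => //= i il.
  by have := sb i; rewrite size_mkseq nth_mkseq //; exact.
have [F [UF ooF]] := ultraFilterLemma (_ : ProperFilter \oo).
(* The witness in [p n] obeys the bound [b] only below [n]. Truncating it gives
   points of a compact box, and each coordinate is affected for finitely many
   [n] only, so that [p] and [q] have the same limit. *)
pose q n : T * baire := ((p n).1, fun i => minn ((p n).2 i) (b i)).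
have qbox n : box (q n).
  by split => /=; [have [] := pP n|move=> i; exact: geq_minr].
move: cptbox; rewrite compact_ultra => /(_ _ (fmap_ultra q UF)) [].
  exact: (@filterE _ F _ _ qbox).
move=> [x s] [bxs qxs].
have pxs : p @ F --> (x, s).
  have -> : p = (fun n => ((p n).1, (p n).2)) by apply/funext => n; case: (p n).
  apply: (@cvg_pair _ _ _ F (nbhs x) (nbhs s)).
    exact: (@cvg_comp _ _ _ q fst F _ _ qxs cvg_fst).
  apply: cvg_baire => i.
  have qs : (fun n => (q n).2) @ F --> s.
    exact: (@cvg_comp _ _ _ q snd F _ _ qxs cvg_snd).
  have := qs _ (nbhs_baire_coord s i); rewrite /nbhs /=.
  have /ooF : \oo [set n | (i < n)%N] by exists i.+1.
  apply: filterS2 => n ni /= <-; apply/esym/minn_idPl.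
  by have [_ _ _] := pP n; exact.
have Cxs : C (x, s).
  apply: (closed_cvg _ cC _ _ pxs).
  by apply: (@filterE _ F) => n; have [] := pP n.
have Vx : V x by apply: KV; exists (x, s).
have pV : (fun n => (p n).1) @ F --> x.
  exact: (@cvg_comp _ _ _ p fst F _ _ pxs cvg_fst).
have /filter_ex[n /= Vpn] : F [set n | V (p n).1].
  by apply: pV; exact: open_nbhs_nbhs.
by have [] := pP n.
Qed.

End capacitability.

(** The compact exhaustion [X] serves to bound the [T] component of the
    projected set. *)
Theorem choquet_capacitability (T : topologicalType) (P : set (set T))
    (X : (set T)^nat) (A : set T) :
  ascending_capacity P ->
  (forall n, compact (X n)) -> {homo X : m n / (m <= n)%N >-> m `<=` n} ->
  \bigcup_n X n = setT ->
  analytic A -> P A ->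
  exists K, [/\ compact K, K `<=` A & forall V, open V -> K `<=` V -> P V].
Proof.
move=> capP cptX ndX XT [C cC AC] PA.
have AE : A = [set x | exists s, C (x, s)].
  rewrite AC; apply/seteqP; split=> [_ [ [x s] Cs <-]|x [s Cs]]; first by exists s.
  by exists (x, s).
have [n PXA] : exists n, P (X n `&` A).
  apply: capP.2; first by move=> m n /ndX mn; exact: setSI.
  by rewrite -setI_bigcupl XT setTI.
rewrite AE; apply: (capacitable_within capP (cptX n) cC).
by rewrite -AE.
Qed.

(** * Outer measure *)

Section outer_measure.
Context d (T : measurableType d) (R : realType) (mu : {measure set T -> \bar R}).

(** For finite [e] this says that the outer measure of [A] exceeds [e], since the
    outer measure is attained by a measurable cover. Quantifying over the covers
    makes continuity of [mu] on measurable sets directly applicable. *)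
Definition outer_gt (e : \bar R) : set (set T) :=
  [set A | forall B, measurable B -> A `<=` B -> (e < mu B)%E].

(** If each [A n] has a measurable cover of measure at most [e], the lower limit
    of these covers is one for the union: a cover of [A k] with [k >= n] also
    covers [A n]. *)
Lemma outer_gt_ascending e : ascending_capacity (outer_gt e).
Proof.
split=> [A B AB eA C mC BC|A ndA eA]; first exact: (eA C mC (subset_trans AB BC)).
apply: contrapT => nA.
have /choice[B B_] n : exists B, [/\ measurable B, A n `<=` B & (mu B <= e)%E].
  apply: contrapT => nB; apply: nA; exists n => B mB AB.
  by rewrite ltNge; apply/negP => Be; apply: nB; exists B.
pose G n := \bigcap_(k in [set k | (n <= k)%N]) B k.
have mG n : measurable (G n).
  by apply: bigcap_measurable => [|k _]; [exists n => /=|case: (B_ k)].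
have mUG : measurable (\bigcup_n G n) by exact: bigcup_measurable.
have ndG : nondecreasing_seq G.
  move=> m n mn; apply/subsetPset => x Gx k /= nk.
  by apply: Gx; exact: leq_trans nk.
have Ge n : (mu (G n) <= e)%E.
  have [mB _ Be] := B_ n; apply: le_trans Be; apply: le_measure; rewrite ?inE//.
  by move=> x; apply => /=.
have cG := @nondecreasing_cvg_mu _ _ _ mu _ mG mUG ndG.
have : (e < mu (\bigcup_n G n))%E.
  apply: eA => // x [n _ Anx]; exists n => // k /= nk.
  by have [_ AB _] := B_ k; apply: AB; exact: ndA Anx.
rewrite ltNge => /negP; apply.
rewrite -(cvg_lim _ cG)//; apply: lime_le; first by apply/cvg_ex; eexists; exact: cG.
by apply: nearW => n /=.
Qed.

Lemma not_negligible_outer_gt (A : set T) :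
  ~ mu.-negligible A -> exists2 e : R, 0 < e & outer_gt e%:E A.
Proof.
move=> nA; apply: contrapT => ne.
have /choice[B B_] n : exists B,
    [/\ measurable B, A `<=` B & (mu B <= (n.+1%:R^-1)%:E)%E].
  apply: contrapT => nB; apply: ne; exists n.+1%:R^-1 => // B mB AB.
  by rewrite ltNge; apply/negP => Be; apply: nB; exists B.
have mB : measurable (\bigcap_n B n).
  by apply: bigcapT_measurable => n; case: (B_ n).
apply: nA; exists (\bigcap_n B n); split => //; last first.
  by move=> x Ax n _; have [_ AB _] := B_ n; exact: AB.
apply/eqP; rewrite -measure_le0; apply/lee_addgt0Pr => e e0; rewrite add0e.
have [n ne0] := ltr_add_invr e0.
have [mBn _ Bn] := B_ n; apply: (@le_trans _ _ (mu (B n))).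
  by apply: le_measure; rewrite ?inE//; exact: bigcap_inf.
by apply: le_trans Bn _; rewrite lee_fin; move: ne0; rewrite add0r => /ltW.
Qed.

End outer_measure.

(** * Measurable selection *)

Section selection.
Variable R : realType.
Local Notation mu := (@lebesgue_measure R).

(** The least [u] above [y] is lower semicontinuous on the projection: the points
    where it is at most [a] are the projection of a compact set. *)
Lemma compact_selection (K : set (R * R)) : compact K ->
  exists2 v : R -> R, measurable_fun (snd @` K) v &
    forall y, (snd @` K) y -> K (v y, y).
Proof.
move=> cK.
have cproj (H : set (R * R)) : compact H -> compact (snd @` H).
  apply: continuous_compact; apply: continuous_subspaceT => p; exact: cvg_snd.
have /choice[v v_] y : exists u, (snd @` K) y ->
    K (u, y) /\ forall u', K (u', y) -> u <= u'.
  have [ [p Kp py]|nKy] := pselect ((snd @` K) y); last by exists 0.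
  have cKy : compact (K `&` snd @^-1` [set y]).
    apply: compact_closedI => //.
    exact: (proj1 (continuous_closedP snd) (fun=> cvg_snd) _ (@closed_eq _ y)).
  have Ky0 : K `&` snd @^-1` [set y] !=set0 by exists p.
  have [q + qmin] := compact_EVT_min Ky0 cKy
    (@continuous_subspaceT _ _ _ fst (fun=> cvg_fst)).
  rewrite inE => -[Kq qy]; exists q.1 => _; split.
    by rewrite -qy -surjective_pairing.
  by move=> u Kuy; apply: (qmin (u, y)); rewrite inE.
have mK (H : set (R * R)) : compact H -> measurable (snd @` H).
  by move=> cH; apply: compact_measurable; exact: cproj.
exists v; last by move=> y /v_[].
apply: (measurability (@RGenOInfty.G R)).
  exact: RGenOInfty.measurableE.
move=> _ [_ [a ->] <-].
have -> : snd @` K `&` v @^-1` `]a, +oo[ =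
    snd @` K `\` snd @` (K `&` fst @^-1` `]-oo, a]).
  apply/seteqP; split=> y [Ky].
    rewrite /= in_itv /= andbT => avy; split => // -[ [u z] [Kuz]].
    rewrite /= in_itv /= => ua zy; move: Kuz; rewrite zy => /(v_ _ Ky).2.
    by move=> vu; move: (lt_le_trans avy vu); rewrite ltNge ua.
  move=> nua; split => //; rewrite /= in_itv /= andbT ltNge; apply/negP => va.
  apply: nua; exists (v y, y) => //; split; first exact: (v_ _ Ky).1.
  by rewrite /= in_itv.
apply: measurableD; apply: mK => //; apply: compact_closedI => //.
have cla : closed `]-oo, a]%classic by exact: interval_closed.
exact: (proj1 (continuous_closedP (@fst R R)) (fun=> cvg_fst) _ cla).
Qed.

Lemma square_compact (n : nat) :
  compact (`[- n%:R, n%:R] `*` `[- n%:R, n%:R] : set (R * R)).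
Proof. by apply: compact_setX; exact: segment_compact. Qed.

(** The projection of [E] may fail to be Borel, but a compact part of [E] has a
    projection of positive measure: were it null, it would have open
    neighbourhoods of arbitrarily small measure, whereas those of the compact
    set chosen here all have measure more than [e]. *)
Theorem measurable_selection (E : set (R * R)) :
  measurable E -> ~ mu.-negligible (snd @` E) ->
  exists D (v : R -> R), [/\ measurable D, (0 < mu D < +oo)%E,
    measurable_fun setT v & forall y, D y -> E (v y, y)].
Proof.
move=> mE /not_negligible_outer_gt[e e0 eE].
pose P := [set A : set (R * R) | outer_gt mu e%:E (snd @` A)].
have [Osub Oup] := @outer_gt_ascending _ _ _ mu e%:E.
have capP : ascending_capacity P.
  split=> [A B AB|A ndA]; first exact/Osub/image_subset.
  rewrite /P /= image_bigcup => /Oup; apply.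
  by move=> m n /ndA; exact: image_subset.
have [] := @choquet_capacitability _ P
  (fun n => `[- n%:R, n%:R] `*` `[- n%:R, n%:R]) E capP (@square_compact) _ _
  (measurable2_bianalytic mE).1 eE.
- move=> m n mn [x y]; rewrite /= !in_itv /=.
  have mnR : m%:R <= n%:R :> R by rewrite ler_nat.
  by lra.
- apply/seteqP; split => // -[x y] _.
  have := truncnS_gt (`|x| + `|y|); set n := (_).+1 => xyn.
  exists n => //=; rewrite !in_itv /= -!ler_norml.
  by have := normr_ge0 x; have := normr_ge0 y; lra.
move=> K [cK KE KV]; have [v mv Kv] := compact_selection cK.
have cD : compact (snd @` K).
  by apply: continuous_compact cK; apply: continuous_subspaceT => p; exact: cvg_snd.
have mD := compact_measurable cD.
exists (snd @` K), (v \_ (snd @` K)); split => //; last first.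
- by move=> y Dy; rewrite patchT ?inE//; exact/KE/Kv.
- exact/(measurable_restrictT _ mD).
have Doo : (mu (snd @` K) < +oo)%E by exact: compact_finite_measure.
rewrite Doo andbT lt_neqAle measure_ge0 andbT eq_sym; apply/eqP => D0.
have [U [oU DU Ue]] := lebesgue_regularity_outer mD Doo e0.
have mU := open_measurable oU.
have : (e%:E < mu U)%E.
  apply: (KV (snd @^-1` U)) => //; last first.
  - by move=> _ [p Up <-].
  - by move=> p Kp; apply: DU; exists p.
  - by apply: open_comp oU => p _; exact: cvg_snd.
rewrite ltNge => /negP; apply.
rewrite -(setDUK DU) measureU ?setDIK//; last exact: measurableD.
suff : (mu (snd @` K) + mu (U `\` snd @` K) <= e%:E)%E by [].
by rewrite D0 add0e; exact: ltW.
Qed.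

End selection.

(** * Pointwise minimization of integral functionals *)

Lemma integral_lt_on d (T : measurableType d) (R : realType)
    (mu : {measure set T -> \bar R}) (D : set T) (f g : T -> R) :
  measurable D -> (0 < mu D)%E ->
  mu.-integrable setT (EFin \o f) -> mu.-integrable setT (EFin \o g) ->
  (forall x, f x <= g x) -> (forall x, D x -> f x < g x) ->
  (\int[mu]_x (f x)%:E < \int[mu]_x (g x)%:E)%E.
Proof.
move=> mD D0 intf intg fg Dfg.
rewrite -sube_gt0 -integralB_EFin//.
have mgf : measurable_fun setT (fun x => ((g x)%:E - (f x)%:E)%E).
  by have /measurable_int := integrableB measurableT intg intf.
rewrite lt_neqAle integral_ge0 ?andbT; last first.
  by move=> x _; rewrite sube_ge0 ?lee_fin.
apply/eqP => /esym I0; move: D0; rewrite lt_neqAle => /andP[/eqP + _]; apply.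
have /(ae_eq_integral_abs mu measurableT mgf) gf0 :
    (\int[mu]_x `|(g x)%:E - (f x)%:E| = 0)%E.
  rewrite -[RHS]I0; apply: eq_integral => x _.
  by rewrite gee0_abs // sube_ge0 ?lee_fin.
apply/esym/(negligibleP mu mD); apply: negligibleS gf0 => x Dx /= /(_ I) [].
by move/eqP; rewrite subr_eq0 => /eqP gfx; have := Dfg x Dx; rewrite gfx ltxx.
Qed.

(** A strict improvement on a non-negligible set of [y] can be carried out by a
    measurable selection on a set of positive measure. Off that set the
    competitor equals [w], which may be non-measurable: integrability is
    therefore required of the composite [f (w' y) y] alone. *)
Theorem ae_minimizer_of_integral (R : realType) (f : R -> R -> R) (w : R -> R) :
  let mu := @lebesgue_measure R in
  jointly_measurable f ->
  mu.-integrable setT (EFin \o (fun y => f (w y) y)) ->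
  (forall w', mu.-integrable setT (EFin \o (fun y => f (w' y) y)) ->
     (\int[mu]_y (f (w y) y)%:E <= \int[mu]_y (f (w' y) y)%:E)%E) ->
  {ae mu, forall y, forall u, f (w y) y <= f u y}.
Proof.
move=> mu [g mg [N [mN N0 Ng]]] intw minw.
pose h y := f (w y) y.
have fg u y : ~ N y -> f u y = g (u, y).
  by move=> Ny; apply: contrapT => fgu; apply: Ny; apply: Ng => /(_ u).
have mh : measurable_fun setT h by have /measurable_int/measurable_EFinP := intw.
(* The lower bound makes the improved cost integrable; for given [u] and [y] it
   holds for [n] large enough. *)
pose E n := [set p : R * R | ~ N p.2 /\ - n%:R <= g p < h p.2].
have mE n : measurable (E n).
  have mh2 : measurable_fun setT (fun p : R * R => h p.2).
    exact: measurableT_comp.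
  have -> : E n = (snd @^-1` (~` N)) `&`
      ([set p | - n%:R <= g p] `&` [set p | g p < h p.2]).
    apply/seteqP; split=> p /=; first by move=> [? /andP[]].
    by move=> [? [? ?]]; split => //; apply/andP.
  apply: measurableI.
    rewrite -[X in measurable X]setTI.
    by apply: measurable_snd => //; exact: measurableC.
  have mtrue (b : R * R -> bool) : measurable_fun setT b ->
      measurable [set p | b p].
    by move=> mb; have := mb measurableT [set true] I; rewrite setTI.
  apply: measurableI; apply: mtrue; last exact: measurable_fun_ltr.
  by apply: measurable_fun_ler => //; exact: measurable_cst.
have [negl|] := pselect (forall n, mu.-negligible (snd @` E n)).
  have : mu.-negligible (N `|` \bigcup_n (snd @` E n)).
    apply: negligibleU; last exact: negligible_bigcup.
    by exists N; split.
  apply: negligibleS => y /= nmin; apply: contrapT => /not_orP[Ny nE].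
  apply: nmin => u; rewrite leNgt; apply/negP => fuh.
  apply: nE; exists (Num.truncn `|f u y|).+1 => //; exists (u, y) => //.
  split => //=; rewrite -fg // fuh andbT.
  by rewrite lerNl (le_trans _ (ltW (truncnS_gt _)))// -normrN ler_norm.
move=> /existsNP[n /(measurable_selection (mE n))].
move=> [D [v [mD /andP[D0 Doo] mv Ev]]]; exfalso.
pose w' y := if y \in D then v y else w y.
have w'E : (fun y => f (w' y) y) = fun y => if y \in D then g (v y, y) else h y.
  apply/funext => y; rewrite /w'; case: ifPn => // /set_mem Dy.
  by rewrite fg //; have [] := Ev y Dy.
have gh y : D y -> - n%:R <= g (v y, y) < h y by move=> /Ev[].
have mw' : measurable_fun setT (fun y => f (w' y) y).
  rewrite w'E; apply: measurable_fun_ifT => //.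
    apply: (measurable_fun_bool true); rewrite setTI.
    rewrite (_ : _ @^-1` _ = D) //.
    by apply/seteqP; split=> y /=; [exact: set_mem|exact: mem_set].
  apply: (measurableT_comp mg).
  by apply: measurable_fun_pair => //; exact: measurable_id.
have intw' : mu.-integrable setT (EFin \o (fun y => f (w' y) y)).
  have : mu.-integrable setT (EFin \o (fun y => `|h y| + n%:R * \1_D y)).
    rewrite (_ : EFin \o _ = ((EFin \o (Num.norm \o h)) \+
      (fun y => n%:R%:E * (\1_D y)%:E))%E); last by [].
    apply: integrableD => //; first exact: integrable_norm.
    apply: integrableZl => //; apply/integrableP; split.
      exact/measurable_EFinP.
    rewrite (eq_integral (fun y => (\1_D y)%:E)); last first.
      by move=> y _; rewrite gee0_abs // lee_fin.
    by rewrite integral_indic // setIT.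
  apply: le_integrable => //; first exact/measurable_EFinP.
  move=> y _; rewrite w'E /= lee_fin indicE; case: ifPn => [/set_mem Dy|_].
    rewrite mulr1 [leRHS]ger0_norm ?addr_ge0 // ler_norml.
    have /andP[ng gh'] := gh y Dy.
    by have := ler_norm (h y); have := normr_ge0 (h y); have := ler0n R n; lra.
  by rewrite mulr0 addr0 normr_id.
have := minw w' intw'; rewrite leNgt => /negP; apply.
apply: (integral_lt_on mD D0 intw' intw) => y; rewrite (congr1 (@^~ y) w'E).
  by case: ifPn => // /set_mem /gh /andP[_ /ltW].
by move=> Dy; rewrite mem_set //; case/andP: (gh y Dy).
Qed.

Theorem corollary1 (R : realType) (M : nat)
    (J : controllers R M -> \bar R)
    (L : forall m : 'I_M, others R m -> R -> R -> R)
    (Res : forall m : 'I_M, others R m -> R)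
    (rho : forall m : 'I_M, others R m -> R -> R)
    (U : controllers R M) :
  (0 < M)%N ->
  (forall (m : 'I_M) (W : others R m), jointly_measurable (L m W)) ->
  (forall (m : 'I_M) (V : controllers R M),
     (@lebesgue_measure R).-integrable setT (EFin \o integrand L m V) ->
     J V = (\int[@lebesgue_measure R]_y (integrand L m V y)%:E
            + (Res m (drop_controller m V))%:E)%E) ->
  (forall m : 'I_M,
     (@lebesgue_measure R).-integrable setT (EFin \o integrand L m U)) ->
  (forall V : controllers R M, (J U <= J V)%E) ->
  forall m : 'I_M,
    {ae (@lebesgue_measure R), forall y,
       is_argmin (fun u => marginal_cost L rho m U u y) (U m y)}.
Proof.
move=> _ mL JE intU minU m.
have {}mL := mL m (drop_controller m U).
have := ae_minimizer_of_integral mL (intU m).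
case=> [w' intw'|N [mN N0 NU]]; last first.
  exists N; split => //; apply: subset_trans NU => y /= nmin minfy; apply: nmin.
  by move=> u; rewrite !marginal_costE lerD2r; exact: minfy.
pose V : controllers R M := fun k => if k == m then w' else U k.
have VU : drop_controller m V = drop_controller m U.
  by apply/funext => -[k km]; rewrite /drop_controller /V /= (negbTE km).
have VE : integrand L m V = fun y => L m (drop_controller m U) (w' y) y.
  by apply/funext => y; rewrite /integrand VU /V eqxx.
have := minU V; rewrite (JE m V) VE // (JE m U (intU m)) VU leeD2rE //.
Qed.
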